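(* Let $h\ge2$ and $\kappa\ge1$ be integers, and let $f:[0,1]\to\mathbb{R}$ be any non-decreasing priority function with $f(0)=1$. On the class of all instances with capacity $C\ge h\cdot n_{\max}$, where $n_{\max}$ is the maximum number of instances demanded by a job, and with job lengths in $[1,\kappa]$, the competitive ratio of the greedy mechanism $\Gamma_G$ with priority function $f$ is no less than $$\frac{h}{h-1}\cdot(\sqrt{\kappa}+1)^2+1 .$$
   Context: Setting. A cloud provider has $C\in\mathbb{N}$ identical instances at every time $t\in[0,\infty)$. A job sequence $\theta$ is a finite list of jobs $\theta_i=(r_i,d_i,n_i,l_i,v_i)$: release time $r_i\ge0$, deadline $d_i$, required number of instances $n_i$ (positive integer, $n_i\le n_{\max}\le C$), length $l_i\in[1,\kappa]$ ($\kappa$ a positive integer), value $v_i>0$. Nothing is known about job $i$ before time $r_i$. An allocation is feasible if at every time the total number of allocated instances is at most $C$. Job $i$ is completed if it receives at least $n_i$ instances continuously for $l_i$ time units between $r_i$ and $d_i$; an interrupted job loses all its progress but may be restarted from scratch. The social welfare of an allocation is the sum of the values of the completed jobs. $OPT(\theta)$ is the maximum social welfare of a feasible allocation computed offline with full knowledge of $\theta$; $W(M,\theta)$ is the social welfare obtained by the online mechanism $M$ on $\theta$ (with truthful reports). Competitiveness. $M$ is $c$-competitive on a class of instances if no instance in the class satisfies $c\cdot W(M,\theta)<OPT(\theta)$. The competitive ratio of $M$ on the class is the least such $c$ ($\infty$ if there is none). Mechanism $\Gamma_G$ with priority function $f$ ($f:[0,1]\to\mathbb{R}$ non-decreasing,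 $f(0)=1$). At time $t$ let $\delta_i\in[0,1]$ be the fraction of $l_i$ for which job $i$ has been continuously processed up to $t$ in its current uninterrupted run ($\delta_i=0$ if it is not running). Job $i$ is feasible at $t$ if $r_i\le t$, $d_i-t\ge(1-\delta_i)l_i$, and it has not been completed. A time is critical if a job is released or a running job is completed at that time. At every critical time $t$, in increasing order: let $J_F$ be the set of feasible jobs; set $v_i'=v_if(\delta_i)$ and $\rho_i'=\frac{v_i}{n_i}f(\delta_i)$; number the jobs of $J_F$ by descending $\rho_i'$ (ties broken by an arbitrary fixed rule). If the total demand $\sum n_i$ of all jobs in $J_F$ is at most $C$, run all of $J_F$. Otherwise let $k$ be the smallest index with $n_1+\dots+n_k>C$; if $\sum_{i=1}^{k-1}v_i'\ge v_k'$ run jobs $1,\dots,k-1$, else run only job $k$. The chosen jobs run (job $i$ on $n_i$ instances) until the next critical time; running jobs that are not chosen are interrupted. (Each completed job pays its critical value, the minimum reported value for which it would be completed; payments do not affect social welfare.) *)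

(* Defs.v *)
From HB Require Import structures.
From mathcomp Require Import all_boot all_order all_algebra.
From mathcomp Require Import boolp classical_sets reals ereal.
Set Implicit Arguments.
Unset Strict Implicit.
Unset Printing Implicit Defensive.
Import Order.TTheory GRing.Theory Num.Theory.
Local Open Scope classical_set_scope.
Local Open Scope ring_scope.

Record job (R : realType) := Job {
  release : R;
  deadline : R;
  demand : nat;
  len : R;
  value : R }.

(* Jobs of a sequence [theta] are referred to by their position in it. *)
Definition job_at (R : realType) (theta : seq (job R)) (i : 'I_(size theta)) :
  job R := tnth (in_tuple theta) i.

Definition nmax (R : realType) (theta : seq (job R)) : nat :=
  \max_(j <- theta) demand j.

Definition valid_job (R : realType) (kappa : nat) (j : job R) : Prop :=
  [/\ 0 <= release j, (0 < demand j)%N, 1 <= len j <= kappa%:R & 0 < value j].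

(* The capacity [C] is part of the instance. *)
Definition capacity_class (R : realType) (h kappa C : nat)
    (theta : seq (job R)) : Prop :=
  (h * nmax theta <= C)%N /\ forall i, valid_job kappa (@job_at R theta i).

Definition allocation (R : realType) (theta : seq (job R)) :=
  'I_(size theta) -> R -> nat.

Definition feasible_allocation (R : realType) (C : nat) (theta : seq (job R))
    (x : allocation theta) : Prop :=
  forall t : R, 0 <= t -> (\sum_i x i t <= C)%N.

(* The processing interval is half-open, so that two jobs may be processed
   back to back on the same instances. *)
Definition completed (R : realType) (theta : seq (job R))
    (x : allocation theta) (i : 'I_(size theta)) : Prop :=
  exists s : R,
    [/\ release (job_at i) <= s, s + len (job_at i) <= deadline (job_at i) &
        forall t, s <= t < s + len (job_at i) -> (demand (job_at i) <= x i t)%N].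

Definition welfare (R : realType) (theta : seq (job R))
    (x : allocation theta) : R :=
  \sum_(i | `[< completed x i >]) value (job_at i).

(* There are finitely many possible welfares, so the supremum is a maximum. *)
Definition opt (R : realType) (C : nat) (theta : seq (job R)) : R :=
  sup [set welfare x | x in feasible_allocation C (theta := theta)].

Definition competitive (R : realType)
    (W : nat -> seq (job R) -> R) (K : nat -> seq (job R) -> Prop) (c : R) :
    Prop :=
  forall C theta, K C theta -> ~ (c * W C theta < opt C theta).

(* Equals +oo when [W] is not [c]-competitive for any [c]. *)
Definition competitive_ratio (R : realType)
    (W : nat -> seq (job R) -> R) (K : nat -> seq (job R) -> Prop) : \bar R :=
  ereal_inf [set c%:E | c in competitive W K].

Definition priority_function (R : realType) (f : R -> R) : Prop :=
  f 0 = 1 /\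
  forall x y, 0 <= x <= 1 -> 0 <= y <= 1 -> x <= y -> f x <= f y.

(* What a tie-breaking rule sees of a job: its position in the job sequence,
   its parameters, and the processed fraction in its current run. *)
Definition snapshot (R : realType) : Type := (nat * job R * R)%type.

Definition linear_order (T : Type) (r : rel T) : Prop :=
  [/\ total r, transitive r & antisymmetric r].

(* State of the mechanism just after the critical time [clock]: [started i] is
   [Some s] iff job [i] is running, in an uninterrupted run begun at time [s];
   [finished] is the set of jobs completed so far. *)
Record state (R : realType) (theta : seq (job R)) := State {
  clock : R;
  started : 'I_(size theta) -> option R;
  finished : {set 'I_(size theta)} }.

(* Release times are nonnegative, so no critical time is skipped. *)
Definition initial_state (R : realType) (theta : seq (job R)) : state theta :=
  State (-1) (fun=> None) finset.set0.

Definition next_critical_time (R : realType) (theta : seq (job R))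
    (st : state theta) : option R :=
  let releases :=
    [seq release (job_at i) | i <- enum 'I_(size theta)
                            & clock st < release (job_at i)] in
  let completions :=
    pmap (fun i => omap (fun s => s + len (job_at i)) (started st i))
         (enum 'I_(size theta)) in
  ohead (sort <=%R (releases ++ completions)).

Definition progress (R : realType) (theta : seq (job R)) (st : state theta)
    (t : R) (i : 'I_(size theta)) : R :=
  if started st i is Some s then (t - s) / len (job_at i) else 0.

Section GreedySelection.
Variables (R : realType) (f : R -> R) (tie : rel (snapshot R)) (C : nat).
Variables (theta : seq (job R)) (delta : 'I_(size theta) -> R).
Implicit Types (i j : 'I_(size theta)) (s : seq 'I_(size theta)).

Definition vprio i : R := value (job_at i) * f (delta i).

Definition rhoprio i : R :=
  value (job_at i) / (demand (job_at i))%:R * f (delta i).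

Definition before i j : bool :=
  (rhoprio j < rhoprio i) ||
  (rhoprio i == rhoprio j) &&
    tie (nat_of_ord i, job_at i, delta i) (nat_of_ord j, job_at j, delta j).

Definition total_demand s : nat := \sum_(i <- s) demand (job_at i).

(* With 0-based positions, the job called k in the selection rule is at
   position [p], and the jobs 1, ..., k-1 are [take p s]. *)
Definition greedy_choice (JF : seq 'I_(size theta)) : seq 'I_(size theta) :=
  let s := sort before JF in
  if (total_demand s <= C)%N then s else
  let p := find (fun m => (C < total_demand (take m.+1 s))%N)
                (iota 0 (size s)) in
  if drop p s is k :: _ then
    if vprio k <= \sum_(i <- take p s) vprio i then take p s else [:: k]
  else [::].

End GreedySelection.

Definition feasible_job (R : realType) (theta : seq (job R)) (t : R)
    (fin : {set 'I_(size theta)}) (delta : 'I_(size theta) -> R)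
    (i : 'I_(size theta)) : bool :=
  [&& release (job_at i) <= t,
      (1 - delta i) * len (job_at i) <= deadline (job_at i) - t
    & i \notin fin].

Definition process (R : realType) (f : R -> R) (tie : rel (snapshot R))
    (C : nat) (theta : seq (job R)) (t : R) (st : state theta) : state theta :=
  let delta := progress st t in
  let fin := (finished st :|:
    [set i | if started st i is Some s then s + len (job_at i) == t
             else false])%SET in
  let JF := [seq i <- enum 'I_(size theta) | feasible_job t fin delta i] in
  let chosen := greedy_choice f tie C delta JF in
  State t
    (fun i => if i \in chosen then Some (odflt t (started st i)) else None)
    fin.

Definition step (R : realType) (f : R -> R) (tie : rel (snapshot R))
    (C : nat) (theta : seq (job R)) (st : state theta) : state theta :=
  if next_critical_time st is Some t then process f tie C t st else st.

Definition greedy_completed (R : realType) (f : R -> R)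
    (tie : rel (snapshot R)) (C : nat) (theta : seq (job R))
    (i : 'I_(size theta)) : Prop :=
  exists m : nat,
    i \in finished (iter m (@step R f tie C theta) (initial_state theta)).

Definition greedy_welfare (R : realType) (f : R -> R)
    (tie : rel (snapshot R)) (C : nat) (theta : seq (job R)) : R :=
  \sum_(i < size theta | `[< greedy_completed f tie C i >]) value (job_at i).

(* Main.v *)
Require Import Defs.
From mathcomp Require Import all_boot all_order all_algebra.
From mathcomp Require Import boolp classical_sets reals ereal.
From mathcomp Require Import zify ring lra.
Import Order.TTheory GRing.Theory Num.Theory.
Local Open Scope ring_scope.
Set Implicit Arguments.
Unset Strict Implicit.
Unset Printing Implicit Defensive.

(* Fix s < 1 close to 1, let a be the supremum of f on [0, 1), and put b = a / s^2.
   The greedy mechanism is given a chain of m + 1 groups of jobs of length kappa,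
   each preempted immediately before its completion by the next group, whose
   value density is b times larger; only the last group is completed.  A group occupies (h - 1) n + 1 of the h n instances, so that no
   further job of demand n fits beside it.  Meanwhile the offline allocation
   runs, at all times, h unit-length jobs of demand n whose density is about that
   of the current group, hence never preempt it, then a last batch whose density
   is about b times that of the last group, released just before this group
   completes, and at last the last group itself, the only one with a loose
   deadline.  As m and n grow, the ratio tends to
     1 + h / (h - 1) * (kappa * b / (b - 1) + b),
   up to a power of s, and kappa * b / (b - 1) + b >= (sqrt kappa + 1)^2 by
   AM-GM. *)

(** * Searching and sorting lists *)

Lemma find_iota (a : pred nat) (n p : nat) :
  (p < n)%N -> a p -> (forall i, (i < p)%N -> ~~ a i) -> find a (iota 0 n) = p.
Proof.
move=> ltpn ap min; have hs : has a (iota 0 n).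
  by apply/hasP; exists p => //; rewrite mem_iota.
have ltf : (find a (iota 0 n) < n)%N by rewrite -{2}(size_iota 0 n) -has_find.
have := nth_find 0 hs; rewrite nth_iota // add0n => af.
case: (ltngtP (find a (iota 0 n)) p) => // [/min|lt]; first by rewrite af.
by have := before_find 0 lt; rewrite nth_iota // add0n ap.
Qed.

Lemma sorted_filter_cat (T : eqType) (r : rel T) (P : pred T) (s : seq T) :
    transitive r -> sorted r s ->
    {in s &, forall x y, P x -> ~~ P y -> ~~ r y x} ->
  s = seq.filter P s ++ seq.filter (predC P) s.
Proof.
move=> rtr; elim: s => [|x s IHs] //= pth Ps.
have/IHs IH : sorted r s by apply: path_sorted pth.
have {}IH : s = seq.filter P s ++ seq.filter (predC P) s.
  by apply: IH => y z ys zs; apply: Ps; rewrite inE ?ys ?zs orbT.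
case: ifPn => Px /=; first by rewrite -IH.
have fP : seq.filter P s = [::].
  apply/eqP; rewrite -size_eq0 size_filter -leqn0 leqNgt -has_count.
  apply/hasPn => y ys; apply/negP => Py.
  have: r x y by move: pth; rewrite path_sortedE // => /andP[/allP ax _]; apply: ax.
  by apply/negP/Ps; rewrite ?inE ?ys ?eqxx ?orbT.
by rewrite fP /= {1}IH fP.
Qed.

Lemma ohead_sortP d (T : orderType d) (s : seq T) (x : T) :
  ohead (sort <=%O s) = Some x -> x \in s /\ {in s, forall y, (x <= y)%O}.
Proof.
have := sort_sorted le_total s; have: sort <=%O s =i s by move=> y; rewrite mem_sort.
case: (sort _ s) => [|y q] //= qs; rewrite path_sortedE; last exact: le_trans.
case/andP=> /allP yq _ [<-]; split=> [|z]; rewrite -qs inE ?eqxx //.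
by case/predU1P => [->|/yq].
Qed.

(** * The greedy selection rule *)

Section Greedy.
Variables (R : realType) (f : R -> R) (tie : rel (snapshot R)) (C : nat).
Variables (theta : seq (job R)) (delta : 'I_(size theta) -> R).
Hypothesis tie_total : total tie.

Local Notation rho := (rhoprio f delta).
Local Notation vp := (vprio f delta).

Lemma before_total : total (before f tie delta).
Proof.
move=> i j; by rewrite /before; case: (ltgtP (rho i) (rho j)) => //=.
Qed.

Lemma before_rhoprio i j : before f tie delta i j -> rho j <= rho i.
Proof. by case/orP=> [/ltW //|/andP[/eqP-> _]]. Qed.

(** The sorted list consists of the jobs in [P] followed by the others, so the jobs before the first
    overflow are exactly those in [P]. Which of the densest jobs outside [P] comes first depends on
    [tie]; hence the last hypothesis speaks of each of them. *)
Lemma greedy_choiceE (JF : seq 'I_(size theta)) (P : pred 'I_(size theta)) :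
    {in JF &, forall x y, P x -> ~~ P y -> rho y < rho x} ->
    (total_demand (seq.filter P JF) <= C)%N ->
    {in JF, forall y, ~~ P y -> {in JF, forall z, ~~ P z -> rho z <= rho y} ->
       (C < total_demand (seq.filter P JF) + demand (job_at y))%N
       /\ vp y <= \sum_(x <- JF | P x) vp x} ->
  greedy_choice f tie C delta JF =i seq.filter P JF.
Proof.
move=> sepP demP headP.
have srt := sort_sorted before_total JF.
have mem_s : sort (before f tie delta) JF =i JF by move=> x; rewrite mem_sort.
have perm_s : perm_eq (sort (before f tie delta) JF) JF by rewrite perm_sort.
have rho_tr : transitive [rel i j | rho j <= rho i].
  by move=> y x z /= yx zy; apply: le_trans zy yx.
have {}srt : sorted [rel i j | rho j <= rho i] (sort (before f tie delta) JF).
  by apply: sub_sorted srt => i j /before_rhoprio.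
rewrite /greedy_choice; set s := sort _ JF in srt mem_s perm_s *.
have s_cat : s = seq.filter P s ++ seq.filter (predC P) s.
  apply: sorted_filter_cat srt _ => // x y; rewrite !mem_s => xs ys Px Py /=.
  by rewrite -ltNge; apply: sepP.
have perm_filter : perm_eq (seq.filter P s) (seq.filter P JF) by exact: perm_filter.
have tdE : total_demand (seq.filter P s) = total_demand (seq.filter P JF).
  exact: perm_big.
have memP : seq.filter P s =i seq.filter P JF by move=> x; rewrite (perm_mem perm_filter).
have rest_s : sorted [rel i j | rho j <= rho i] (seq.filter (predC P) s).
  exact: sorted_filter srt.
have td_cat s1 s2 : total_demand (s1 ++ s2) = (total_demand s1 + total_demand s2)%N.
  by rewrite /total_demand big_cat.
case eq_rest: (seq.filter (predC P) s) s_cat rest_s => [|k B] s_cat rest_s.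
  by rewrite cats0 in s_cat; rewrite s_cat tdE demP.
have kP : (k \in JF) && ~~ P k.
  have: k \in seq.filter (predC P) s by rewrite eq_rest mem_head.
  by rewrite mem_filter mem_s andbC.
case/andP: kP => ks Pk.
have [] := headP k ks Pk.
  move=> z zs Pz; have: z \in k :: B by rewrite -eq_rest mem_filter mem_s /= Pz.
  rewrite inE => /predU1P[-> //|zB].
  by move: rest_s; rewrite /= path_sortedE // => /andP[/allP/(_ z zB)].
move=> ltC lev.
set p := find _ _; have -> : p = size (seq.filter P s).
  apply: find_iota; first by rewrite {2}s_cat size_cat /= -addSnnS leq_addr.
    rewrite {2}s_cat take_cat ifN -?leqNgt // subSn // subnn /= take0.
    by rewrite td_cat tdE {2}/total_demand big_seq1.
  move=> i lti; rewrite -leqNgt {1}s_cat takel_cat //.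
  apply: leq_trans demP; rewrite -tdE.
  by rewrite -[X in (_ <= total_demand X)%N](cat_take_drop i.+1) td_cat leq_addr.
have -> : (total_demand s <= C)%N = false.
  apply/negbTE; rewrite -ltnNge s_cat td_cat tdE.
  by apply: leq_trans ltC _; rewrite {3}/total_demand big_cons; lia.
have -> : drop (size (seq.filter P s)) s = k :: B.
  by rewrite {2}s_cat drop_size_cat.
have -> : take (size (seq.filter P s)) s = seq.filter P s.
  by rewrite {2}s_cat take_size_cat.
by rewrite big_filter (perm_big JF) //= lev.
Qed.

End Greedy.

(** Lets the jobs of a list be addressed by labels in a structured type, here group or batch
    together with a rank, instead of by position. *)
Lemma labelling (R : realType) (I : finType) (J : I -> job R) :
  exists lab : 'I_(size [seq J x | x <- enum I]) -> I,
    bijective lab /\ forall i, job_at i = J (lab i).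
Proof.
set theta := map _ _; have sz : size theta = #|I| by rewrite size_map cardE.
exists (fun i => enum_val (cast_ord sz i)); split.
  exists (fun x => cast_ord (esym sz) (enum_rank x)) => i.
    by rewrite enum_valK cast_ordK.
  by rewrite cast_ordKV enum_rankK.
move=> i; rewrite /job_at (tnth_nth (J (enum_val (cast_ord sz i)))) /=.
have x0 := enum_val (cast_ord sz i).
rewrite (nth_map x0) ?(enum_val_nth x0) //=.
  by rewrite -cardE -sz ltn_ord.
Qed.

(** * The adversarial instance *)

Section Adversary.
Variables (R : realType) (f : R -> R) (tie : rel (snapshot R)).
Variables (h kappa n m : nat) (a b s d eta : R).
Hypotheses (tie_total : total tie) (f_prio : priority_function f).
Hypotheses (h_ge2 : (2 <= h)%N) (kappa_gt0 : (0 < kappa)%N) (n_gt0 : (0 < n)%N).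
Hypotheses (s_gt0 : 0 < s) (s_lt1 : s < 1) (a_ge1 : 1 <= a) (bs2 : b * s ^+ 2 = a).
Hypotheses (d_ge0 : 0 <= d) (d_lt1 : d < 1).
Hypotheses (f_lea : forall x, 0 <= x < 1 -> f x <= a) (f_d : a * s <= f d).
Hypotheses (eta_gt0 : 0 < eta) (eta_lt : m.+1%:R * eta < kappa%:R * (1 - d)).

(** Release time of group [j]: the previous group then has only [eta] left to run. *)
Let T (j : nat) : R := j%:R * (kappa%:R - eta).
(* The batches are released back to back so that the last one starts at
   [T m.+1], which is [eta] before the completion of the last group. *)
Let S (k : nat) : R := T m.+1 - (m * kappa)%:R + k%:R.
Let I : finType := ('I_m.+1 * 'I_h + 'I_(m * kappa).+1 * 'I_h)%type.

(* [inl (j, r)] is the r-th job of group j, and [inr (k, r)] the r-th job of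
   the k-th unit-length batch.  The job [inl (j, 0)] has demand 1; its density
   is lower than that of the others so that, at the release of the next group,
   some job of demand n precedes it in the greedy order and blocks it. *)
Let size_of (x : I) : nat :=
  match x with inl (_, r) => if r == 0 :> nat then 1%N else n | inr _ => n end.

(** The exponent 5 leaves room: at progress at least [d], the jobs of group [j] have priority at
    least [s * b ^+ j * (a * s) = s ^+ 4 * b ^+ j.+1], just above a batch with [k %/ kappa = j]. *)
Let density (x : I) : R :=
  match x with
  | inl (j, r) => (if r == 0 :> nat then s else 1) * b ^+ j
  | inr (k, _) => s ^+ 5 * b ^+ (k %/ kappa).+1
  end.

(** Outside group [m] the deadlines leave no slack, so a rejected or interrupted job is lost. The
    last group may still start at [T m.+1 + 1], the end of the last batch. *)
Let adv_job (x : I) : job R :=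
  match x with
  | inl (j, _) => Job (T j)
      (if j == m :> nat then T m.+1 + 1 + kappa%:R else T j + kappa%:R)
      (size_of x) kappa%:R ((size_of x)%:R * density x)
  | inr (k, _) => Job (S k) (S k + 1) (size_of x) 1 ((size_of x)%:R * density x)
  end.

Let theta := [seq adv_job x | x <- enum I].

Section Labelled.
Variable lab : 'I_(size theta) -> I.
Hypotheses (lab_bij : bijective lab) (lab_job : forall i, job_at i = adv_job (lab i)).

Let group (j : nat) (i : 'I_(size theta)) : bool :=
  if lab i is inl (j', _) then j' == j :> nat else false.

Let kappa_ge1 : 1 <= kappa%:R :> R. Proof. by rewrite ler1n. Qed.

Let eta_ltk : m.+1%:R * eta < kappa%:R.
Proof. by have := kappa_ge1; have := d_ge0; have := eta_lt; nra. Qed.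

Let eta_small : eta < kappa%:R.
Proof.
apply: le_lt_trans eta_ltk; rewrite -{1}[eta]mul1r ler_wpM2r ?ler1n //.
exact: ltW.
Qed.

Let T_S j : T j.+1 = T j + (kappa%:R - eta).
Proof. by rewrite /T -[in LHS]addn1 natrD mulrDl mul1r. Qed.

Let T_le i j : (i <= j)%N -> T i <= T j.
Proof. by move=> le_ij; rewrite ler_wpM2r ?ler_nat // subr_ge0 ltW. Qed.

Let T0 : T 0 = 0. Proof. exact: mul0r. Qed.

Let T_ge0 j : 0 <= T j. Proof. by rewrite -T0; apply: T_le. Qed.

Let SE k : S k = kappa%:R - m.+1%:R * eta + k%:R.
Proof. by rewrite /S /T natrM -[m.+1]addn1 natrD; ring. Qed.

(** The groups drift by [eta] each against the unit grid of the batches. A batch of index at least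
    [j * kappa] thus finds group [j], if still running, with at most [m.+1%:R * eta] left. *)
Let S_T k j : (j * kappa <= k)%N -> kappa%:R - m.+1%:R * eta + j%:R * eta <= S k - T j.
Proof.
move=> le_jk; have: (j * kappa)%:R <= k%:R :> R by rewrite ler_nat.
by rewrite SE /T natrM; lra.
Qed.

Let S_end k : (k <= m * kappa)%N -> S k < T m + kappa%:R.
Proof.
move=> le_k; have: k%:R <= (m * kappa)%:R :> R by rewrite ler_nat.
by rewrite /S T_S; have := eta_gt0; lra.
Qed.

Let b_gt0 : 0 < b.
Proof.
by rewrite -(pmulr_lgt0 _ (exprn_gt0 2 s_gt0)) bs2 (lt_le_trans ltr01).
Qed.

Let b_ge1 : 1 <= b.
Proof.
rewrite (le_trans a_ge1) // -bs2 ler_piMr ?ltW //.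
by rewrite exprn_ilt1 // ltW.
Qed.

Let f_ge1 x : 0 <= x <= 1 -> 1 <= f x.
Proof.
case: f_prio => f0 fm x01; rewrite -f0; apply: fm => //; first by rewrite lexx ler01.
by case/andP: x01.
Qed.

Let ltk (k : 'I_(m * kappa).+1) : (k <= m * kappa)%N.
Proof. by rewrite -ltnS. Qed.

Let size_gt0 x : (0 < size_of x)%N.
Proof. by case: x => [[j r]|[k r]] //=; case: ifP. Qed.

Let density_gt0 x : 0 < density x.
Proof.
case: x => [[j r]|[k r]] /=; last by rewrite mulr_gt0 ?exprn_gt0.
by case: ifP => _; rewrite mulr_gt0 ?exprn_gt0.
Qed.

Let adv_demand x : demand (adv_job x) = size_of x.
Proof. by case: x => [[]|[]]. Qed.

Let adv_value x : value (adv_job x) = (size_of x)%:R * density x.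
Proof. by case: x => [[]|[]]. Qed.

Let rhoprioE (delta : 'I_(size theta) -> R) i :
  rhoprio f delta i = density (lab i) * f (delta i).
Proof.
rewrite /rhoprio lab_job adv_value adv_demand [X in X / _]mulrC mulfK //.
by rewrite pnatr_eq0 -lt0n.
Qed.

Let vprioE (delta : 'I_(size theta) -> R) i :
  vprio f delta i = (size_of (lab i))%:R * rhoprio f delta i.
Proof. by rewrite rhoprioE /vprio lab_job adv_value mulrA. Qed.

Let big_group (V : Type) (idx : V) (op : Monoid.com_law idx) (j : 'I_m.+1) (F : I -> V) :
  \big[op/idx]_(i | group j i) F (lab i) = \big[op/idx]_(r < h) F (inl (j, r)).
Proof.
case: lab_bij => unlab labK unlabK.
rewrite (reindex unlab); last by apply: onW_bij; exists lab.
under eq_bigr do rewrite unlabK.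
under eq_bigl do rewrite /group unlabK.
rewrite big_sumType /= [X in op _ X]big_pred0_eq Monoid.mulm1.
transitivity (\big[op/idx]_(l | l == j) \big[op/idx]_(r < h) F (inl (l, r))).
  by rewrite pair_big; apply: eq_big => [[l r]|[l r] _] //=; rewrite andbT.
by rewrite big_pred1_eq.
Qed.

(** Group [j] stops running at [Tend j], being preempted by the next group or, for [j = m],
    completed. *)
Let Tend (j : nat) : R := if j == m then T m + kappa%:R else T j.+1.

Let Tend_le j : Tend j <= T j + kappa%:R.
Proof. by rewrite /Tend; case: eqP => [->//|_]; rewrite T_S; have := eta_gt0; lra. Qed.

Let stage (j : nat) (st : state theta) : Prop :=
  [/\ T j <= clock st < Tend j, finished st = finset.set0 &
      forall i, started st i = if group j i then Some (T j) else None].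

Let h_gt0 : (0 < h)%N. Proof. exact: ltnW. Qed.

Let sum_size j : (\sum_(r < h) size_of (inl (j, r)) = (h.-1 * n).+1)%N.
Proof.
rewrite (bigD1 (Ordinal h_gt0)) //= (eq_bigr (fun=> n)).
  rewrite sum_nat_const (eq_card (B := predC1 (Ordinal h_gt0))) ?add1n //.
  by rewrite cardC1 card_ord.
by move=> r r0; rewrite ifN //; apply: contraNneq r0 => r0; apply/eqP/val_inj.
Qed.

(** * A critical time while the chain is running *)

Section Process.
Variables (st : state theta) (t : R) (j : 'I_m.+1) (j' : nat).
Hypotheses (fin0 : finished st = finset.set0) (t_in : T j <= t < Tend j).
(* The last case, where no job has index j', is the initial state. *)
Hypothesis j'P : j' = j \/ t = T j /\ (j'.+1 = j \/ (m < j')%N).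
Hypothesis stE : forall i, started st i = if group j' i then Some (T j') else None.

Let delta := progress st t.

Let group_le l i : group l i -> (l <= m)%N.
Proof. by rewrite /group; case: (lab i) => // -[[l' lt_l'] _] /= /eqP <-. Qed.

Let group_uniq l l' i : group l i -> group l' i -> l = l'.
Proof. by rewrite /group; case: (lab i) => // -[k _] /eqP-> /eqP->. Qed.

Let lenE i : len (job_at i) = if lab i is inl _ then kappa%:R else 1.
Proof. by rewrite lab_job; case: (lab i) => [[]|[]]. Qed.

Let deltaE i : delta i = if group j' i then (t - T j') / kappa%:R else 0.
Proof.
rewrite /delta /progress stE lenE; case: ifP => //.
by rewrite /group; case: (lab i).
Qed.

Let t_lt : t < T j + kappa%:R.
Proof. by case/andP: t_in => _ /lt_le_trans; apply. Qed.

Let delta_group i : group j i -> delta i = (t - T j) / kappa%:R.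
Proof.
rewrite deltaE => ji; case: ifP => [j'i|]; first by rewrite (group_uniq ji j'i).
case: j'P => [->|[-> _]]; first by rewrite ji.
by rewrite subrr mul0r.
Qed.

Let delta_in i : 0 <= delta i < 1.
Proof.
have k0 : 0 < kappa%:R :> R by rewrite ltr0n.
rewrite deltaE; case: ifP => [j'i|_]; last by rewrite lexx ltr01.
rewrite ltr_pdivrMr // mul1r divr_ge0 ?(ltW k0) //=.
  case: j'P => [->|[-> [<-|]]]; first by have := t_lt; lra.
    by rewrite T_S; have := eta_gt0; lra.
  by rewrite ltnNge (group_le j'i).
rewrite subr_ge0; case: j'P => [->|[-> [<-|]]]; first by case/andP: t_in.
  exact: T_le.
by rewrite ltnNge (group_le j'i).
Qed.

Let delta_le1 i : 0 <= delta i <= 1.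
Proof. by case/andP: (delta_in i) => -> /ltW->. Qed.

Let group_feasible i : group j i -> feasible_job t finset.set0 delta i.
Proof.
move=> ji; rewrite /feasible_job finset.in_set0 andbT delta_group //.
have k0 : kappa%:R != 0 :> R by rewrite pnatr_eq0 -lt0n.
move: ji; rewrite lab_job /group; case: (lab i) => // -[l r] /= /eqP eq_l.
rewrite eq_l mulrBl mul1r divfK //; case/andP: t_in => -> _ /=.
case: eqP => [eq_m|_]; last by lra.
have -> : T m.+1 = T j + (kappa%:R - eta) by rewrite T_S eq_m.
by have := eta_small; lra.
Qed.

(** Without slack, a batch can start only at its release, and an earlier group stays feasible only
    while running: this leaves the previous group, at the instant [T j] of its preemption. Later
    groups are not yet released. *)
Let feasible_other i : feasible_job t finset.set0 delta i -> ~~ group j i ->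
  match lab i with
  | inl (l, _) => [/\ t = T j, l.+1 = j & delta i = (T j - T l) / kappa%:R]
  | inr (k, _) => t = S k
  end.
Proof.
rewrite /feasible_job finset.in_set0 andbT deltaE lab_job /group.
have kN0 : kappa%:R != 0 :> R by rewrite pnatr_eq0 -lt0n.
case: (lab i) => [[l r]|[k r]] /=; last first.
  by move=> /andP[le1 le2] _; apply: le_anti; rewrite le1 andbT; lra.
move=> /andP[le1 le2] neq_lj.
have lt_lj : (l < j)%N.
  rewrite ltn_neqAle neq_lj leqNgt; apply/negP => lt_jl.
  have jm : (j < m)%N by rewrite (leq_trans lt_jl) // -ltnS.
  move: t_in; rewrite /Tend ltn_eqF // => /andP[_]; rewrite ltNge.
  by rewrite (le_trans (T_le lt_jl)).
have l_m : (l == m :> nat) = false.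
  by apply/negbTE; rewrite ltn_eqF // (leq_trans lt_lj) // -ltnS.
move: le2; rewrite l_m; case: eqP => [eq_l|_]; last first.
  rewrite subr0 mul1r => le2; have := T_le lt_lj; rewrite T_S.
  by case/andP: t_in; have := eta_small; lra.
have neq_j'j : j' <> j by move=> e; move: neq_lj; rewrite eq_l e eqxx.
case: j'P => // -[-> [e|]]; last by rewrite -eq_l ltnNge -ltnS ltn_ord.
by rewrite -e -eq_l.
Qed.

Let main_rank : 'I_h := Ordinal h_ge2.

(** There are two kinds of rivals. The previous group gains at most a factor [a] by its progress,
    which is less than [s * b]. A batch has progress 0, and either its density is at most
    [s ^+ 5 * b ^+ j] or it arrives when group [j] has progress at least [d]. *)
Let rho_sep x y : group j x -> feasible_job t finset.set0 delta y ->
  ~~ group j y -> rhoprio f delta y < rhoprio f delta x.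
Proof.
move=> jx feas_y ny.
have bj0 : 0 < b ^+ j by rewrite exprn_gt0.
have rx : s * b ^+ j * f (delta x) <= rhoprio f delta x.
  rewrite rhoprioE ler_wpM2r //; first by rewrite (le_trans ler01) // f_ge1.
  move: jx; rewrite /group; case: (lab x) => // -[l r] /= /eqP->.
  by case: ifP => _ //; rewrite ler_wpM2r // ltW.
apply: lt_le_trans rx; rewrite rhoprioE.
have := feasible_other feas_y ny; have := deltaE y; rewrite /group.
case: (lab y) => [[l r]|[k r]] /=.
  move=> _ [eq_t eq_j eq_d].
  have -> : s * b ^+ j * f (delta x) = s * b * (b ^+ l * f (delta x)).
    by rewrite -eq_j exprS; ring.
  have bl0 : 0 < b ^+ l by rewrite exprn_gt0.
  have a_lt : a < s * b.
    by rewrite -bs2 mulrC ltr_pM2r // expr2 gtr_pMr.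
  have fy : f (delta y) <= a by rewrite f_lea.
  have fy0 : 0 <= f (delta y) by rewrite (le_trans ler01) ?f_ge1.
  apply: (@le_lt_trans _ _ (b ^+ l * a)).
    rewrite -mulrA; case: ifP => _; last by rewrite mul1r ler_wpM2l // ltW.
    rewrite -[leRHS]mul1r ler_pM ?(ltW s_lt1) ?(ltW s_gt0) //.
      by rewrite mulr_ge0 // ltW.
    by rewrite ler_wpM2l // ltW.
  rewrite [ltLHS]mulrC; apply: (@lt_le_trans _ _ (s * b * b ^+ l)).
    by rewrite ltr_pM2r.
  rewrite [leRHS]mulrA ler_peMr ?f_ge1 //; apply: ltW.
  by rewrite mulr_gt0 // mulr_gt0.
move=> -> eq_t.
have f0 : f 0 = 1 by case: f_prio.
rewrite f0 mulr1.
case: (leqP (k %/ kappa).+1 j) => [le_j|lt_j].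
  apply: (@lt_le_trans _ _ (s * b ^+ (k %/ kappa).+1)).
    by rewrite ltr_pM2r ?exprn_gt0 // -[ltRHS]expr1 ltr_iXn2l.
  rewrite -[leLHS]mulr1 ler_pM ?f_ge1 // ?mulr_ge0 ?(ltW s_gt0) ?exprn_ge0 ?(ltW b_gt0) //.
  by rewrite ler_pM2l // ler_weXn2l.
have le_k : (j * kappa <= k)%N by rewrite -leq_divRL.
(* A batch of larger index is released after [Tend j] or, for [j = m], does not exist. *)
have lt_k : (k < j.+1 * kappa)%N.
  rewrite ltnNge; apply/negP => le_k'; case: (ltngtP j m) => jm.
  - move: t_in (S_T le_k'); rewrite /Tend ltn_eqF // eq_t => /andP[_].
    have: 0 <= j.+1%:R * eta by rewrite mulr_ge0 // ltW.
    by have := eta_ltk; lra.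
  - by move: jm; rewrite ltnNge -ltnS ltn_ord.
  - have := leq_trans le_k' (ltk k).
    by rewrite jm mulSn -[leqRHS]add0n leq_add2r leqNgt kappa_gt0.
have -> : (k %/ kappa = j)%N.
  by apply/eqP; rewrite eqn_leq -ltnS ltn_divLR // lt_k leq_divRL.
(* The bound [eta_lt] on the total drift ensures that group [j] has reached progress [d] at time
   [S k]. *)
have fx : a * s <= f (delta x).
  apply: (le_trans f_d); case: f_prio => _; apply; rewrite ?d_ge0 ?(ltW d_lt1) //.
  rewrite delta_group // ler_pdivlMr ?ltr0n // eq_t.
  have: 0 <= j%:R * eta by rewrite mulr_ge0 // ltW.
  by have := S_T le_k; have := eta_lt; lra.
apply: (@lt_le_trans _ _ (s * b ^+ j * (a * s))); last first.
  by rewrite ler_pM2l // mulr_gt0.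
have -> : s * b ^+ j * (a * s) = s ^+ 4 * b ^+ j.+1.
  by rewrite -bs2 (exprS b); ring.
by rewrite ltr_pM2r ?exprn_gt0 // ltr_iXn2l.
Qed.

Let fin1 : (finished st :|:
    [set i | if started st i is Some u then u + len (job_at i) == t
             else false])%SET = finset.set0.
Proof.
rewrite fin0 finset.set0U; apply/setP => i; rewrite !inE stE.
case: ifP => // j'i; rewrite lenE; move: (j'i); rewrite /group.
case: (lab i) => // -[l r] _; apply: gt_eqF.
case: j'P => [->|[-> [<-|]]] //; first by rewrite T_S; have := eta_gt0; lra.
by rewrite ltnNge (group_le j'i).
Qed.

(** Group [j] outranks every rival and leaves only [n - 1] instances free, so it is selected alone
    as soon as the first rival in the order has demand [n] and no larger priority value. *)
Lemma process_stage : stage j (process f tie (h * n) t st).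
Proof.
rewrite /process fin1 -/delta; set JF := [seq i <- _ | _].
have groupJF (V : Type) (idx : V) (op : Monoid.com_law idx) (F : 'I_(size theta) -> V) :
    \big[op/idx]_(i <- JF | group j i) F i = \big[op/idx]_(i | group j i) F i.
  rewrite big_filter_cond big_enum_cond /=; apply: eq_bigl => i.
  by rewrite andb_idl // => /group_feasible.
have td : total_demand (seq.filter (group j) JF) = (h.-1 * n).+1.
  rewrite /total_demand big_filter groupJF.
  under eq_bigr do rewrite lab_job adv_demand.
  by rewrite big_group sum_size.
have hn : (h * n = h.-1 * n + n)%N by rewrite -{1}(prednK h_gt0) mulSn addnC.
have mem_JF i : i \in JF = feasible_job t finset.set0 delta i.
  by rewrite mem_filter mem_enum andbT.
have chosenE : greedy_choice f tie (h * n) delta JF =i seq.filter (group j) JF.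
  apply: greedy_choiceE => //.
  - by move=> x y; rewrite !mem_JF => _ feas_y jx ny; apply: rho_sep.
  - by rewrite td hn -addn1 leq_add2l.
  move=> y; rewrite mem_JF => feas_y ny max_y.
  (* The job of demand 1 is never a densest rival: a job of demand [n] in the same group has the
     same progress and is denser by the factor [1 / s]. *)
  have size_y : size_of (lab y) = n.
    have := feasible_other feas_y ny; case eq_y: (lab y) => [[l r]|//] /= _.
    case: eqP => // r0; case: lab_bij => unlab labK unlabK.
    pose z := unlab (inl (l, main_rank)).
    have eq_z : lab z = inl (l, main_rank) by rewrite unlabK.
    have delta_z : delta z = delta y by rewrite !deltaE /group eq_z eq_y.
    have feas_z : feasible_job t finset.set0 delta z.
      by move: feas_y; rewrite /feasible_job !finset.in_set0 delta_z !lab_job eq_y eq_z.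
    have nz : ~~ group j z by move: ny; rewrite /group eq_z eq_y.
    have := max_y z; rewrite mem_JF => /(_ feas_z nz).
    rewrite !rhoprioE eq_y eq_z delta_z /= r0 eqxx mul1r.
    rewrite ler_pM2r; last by rewrite (lt_le_trans ltr01) ?f_ge1.
    by rewrite leNgt gtr_pMl ?exprn_gt0 // s_lt1.
  rewrite td; split; first by rewrite lab_job adv_demand size_y hn addSn.
  rewrite groupJF; case: lab_bij => unlab labK unlabK.
  (* A single job of demand [n] in group [j] already outweighs the rival, which has equal demand and
     lower priority per instance. *)
  pose x := unlab (inl (j, main_rank)).
  have eq_x : lab x = inl (j, main_rank) by rewrite unlabK.
  have jx : group j x by rewrite /group eq_x.
  rewrite (bigD1 x) //= -[leLHS]addr0 lerD //; last first.
    apply: sumr_ge0 => i _; rewrite vprioE rhoprioE mulr_ge0 ?ler0n //.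
    by rewrite mulr_ge0 ?(ltW (density_gt0 _)) // (le_trans ler01) ?f_ge1.
  by rewrite !vprioE size_y eq_x /= ler_wpM2l ?ler0n // ltW // rho_sep.
split=> //= i; rewrite chosenE mem_filter mem_JF stE.
case: (boolP (group j i)) => //= ji; rewrite group_feasible //.
case: ifP => [j'i|nj'i] /=; first by rewrite (group_uniq ji j'i).
by case: j'P => [e|[-> //]]; rewrite e ji in nj'i.
Qed.

End Process.

(** * The whole run of the mechanism *)

Let finale (st : state theta) : Prop :=
  [/\ T m + kappa%:R <= clock st, forall i, started st i = None &
      forall i, (i \in finished st) = group m i].

(** Every job outside the last group has passed its latest possible start. *)
Let nothing_feasible (st : state theta) (t : R) (delta : 'I_(size theta) -> R) :
    T m + kappa%:R <= t ->
    (forall i, ~~ group m i -> delta i = 0) ->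
  forall i, ~~ group m i -> ~~ feasible_job t finset.set0 delta i.
Proof.
move=> le_t d0 i ni; rewrite /feasible_job d0 // subr0 mul1r.
move: ni; rewrite /group lab_job; case: (lab i) => [[l r]|[k r]] /=.
  move=> l_m; rewrite (negbTE l_m); apply/negP => /and3P[_ le2 _].
  have lt_lm : (l < m)%N by rewrite ltn_neqAle l_m -ltnS ltn_ord.
  by have := T_le lt_lm; rewrite T_S; have := eta_small; have := kappa_ge1; lra.
by move=> _; apply/negP => /and3P[_ le2 _]; have := S_end (ltk k); lra.
Qed.

Let process_finale st t :
    T m + kappa%:R <= t -> finale st \/ t = T m + kappa%:R /\ stage m st ->
  finale (process f tie (h * n) t st).
Proof.
move=> le_t stP; rewrite /process.
set fin := (_ :|: _)%SET; set JF := [seq i <- _ | _].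
have finE i : (i \in fin) = group m i.
  rewrite !inE; case: stP => [[_ st0 ->]|[-> [_ -> ->]]].
    by rewrite st0 orbF.
  rewrite finset.in_set0 /=; case: ifP => // mi.
  by move: mi; rewrite lab_job /group; case: (lab i) => [[]|//] /=; rewrite eqxx.
have -> : JF = [::].
  apply/eqP; rewrite -[_ == _]negbK -has_filter; apply/hasPn => i _.
  case: (boolP (group m i)) => mi; first by rewrite /feasible_job finE mi !andbF.
  have := @nothing_feasible st t (progress st t) le_t _ i mi.
  rewrite /feasible_job finE (negbTE mi) finset.in_set0; apply=> k nk.
  rewrite /progress; case: stP => [[_ -> _] //|[_ [_ _ ->]]].
  by rewrite (negbTE nk).
split=> // i.
by rewrite /greedy_choice /total_demand /= big_nil.
Qed.

Let mem_next (st : state theta) t : next_critical_time st = Some t ->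
  [/\ (exists i : 'I_(size theta), t = release (job_at i) /\ clock st < t) \/
      (exists i u, started st i = Some u /\ t = u + len (job_at i)),
      forall i : 'I_(size theta), clock st < release (job_at i) -> t <= release (job_at i) &
      forall i u, started st i = Some u -> t <= u + len (job_at i)].
Proof.
case/ohead_sortP; rewrite mem_cat => t_in t_min; split.
- case/orP: t_in => [/mapP[i]|]; rewrite ?mem_pmap.
    by rewrite mem_filter => /andP[lt_i _] ->; left; exists i.
  case/mapP => i _; case eq_i: (started st i) => [u|] //= [->].
  by right; exists i, u.
- move=> i lt_i; apply: t_min; rewrite mem_cat map_f // mem_filter lt_i.
  by rewrite mem_enum.
move=> i u eq_i; apply: t_min; rewrite mem_cat mem_pmap; apply/orP; right.
by apply/mapP; exists i; rewrite ?mem_enum // eq_i.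
Qed.

Let simulation (N : nat) :
  let st := iter N (@step R f tie (h * n) theta) (initial_state theta) in
  [\/ st = initial_state theta, exists j : 'I_m.+1, stage j st | finale st].
Proof.
case: lab_bij => unlab labK unlabK.
pose leader (j : 'I_m.+1) := unlab (inl (j, Ordinal h_gt0)).
have leaderT j : release (job_at (leader j)) = T j by rewrite lab_job unlabK.
have group_leader (j : 'I_m.+1) : group j (leader j) by rewrite /group unlabK.
elim: N => [|N] /=; first by constructor 1.
set st := iter _ _ _; case=> stP; rewrite /step; case eq_t: next_critical_time => [t|].
- have [t_mem t_rel _] := mem_next eq_t; constructor 2; exists ord0.
  (* The first critical time is the release of group 0, as every batch has [S k > 0]. *)
  have t0 : t = T 0.
    apply: le_anti; rewrite -{1}(leaderT ord0) t_rel /=; last first.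
      by rewrite leaderT stP /= T0 ltrN10.
    case: t_mem => [[i [-> _]]|[i [u []]]]; last by rewrite stP.
    rewrite lab_job T0; case: (lab i) => [[l r]|[k r]] /=; first exact: T_ge0.
    by rewrite SE; have := eta_ltk; have := ler0n R k; lra.
  have := @process_stage st t ord0 m.+1; apply.
  + by rewrite stP.
  + rewrite t0 lexx /Tend; case: eqP => [<-|_].
      by rewrite T0 add0r ltr0n.
    by rewrite T_S; have := eta_small; lra.
  + by right; split=> //; right.
  + move=> i; rewrite stP /=; case: ifP => //; rewrite /group.
    by case: (lab i) => // -[l r] /= /eqP e; have := ltn_ord l; rewrite e ltnn.
- by constructor 1.
- case: stP => j stj; have [clk fin0 stE] := stj.
  have [t_mem t_rel t_run] := mem_next eq_t.
  have lt_t : clock st < t.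
    case: t_mem => [[i []] //|[i [u [eq_u ->]]]]; move: eq_u; rewrite stE.
    case: ifP => // ji [<-]; case/andP: clk => _ /lt_le_trans; apply.
    move: ji; rewrite /group lab_job; case: (lab i) => // -[l r] _.
    exact: Tend_le.
  (* The next critical time cannot jump over [Tend j], at which the last group completes or group
     [j.+1] is released. *)
  have le_t : t <= Tend j.
    rewrite /Tend; case: eqP => [eq_jm|/eqP neq_jm].
      have := t_run (leader j) (T j); rewrite stE group_leader lab_job unlabK /=.
      have -> : T m = T j by rewrite eq_jm.
      by apply.
    have lt_jm : (j.+1 < m.+1)%N by rewrite ltnS ltn_neqAle neq_jm -ltnS ltn_ord.
    have := t_rel (leader (Ordinal lt_jm)); rewrite leaderT /=; apply.
    by case/andP: clk => _; rewrite /Tend (negbTE neq_jm).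
  (* Before [Tend j] the stage persists; at [Tend j] the next group takes over or, for [j = m], the
     finale begins. *)
  case: (ltrP t (Tend j)) => [lt_tT|ge_tT].
    constructor 2; exists j; apply: (@process_stage st t j j) => //; last by left.
    by rewrite lt_tT andbT; case/andP: clk => /le_trans + _; apply; apply: ltW.
  have eq_tT : t = Tend j by apply: le_anti; rewrite le_t.
  case: (eqVneq (j : nat) m) => [eq_jm|neq_jm].
    constructor 3; apply: process_finale.
      by rewrite eq_tT /Tend eq_jm eqxx.
    right; split; first by rewrite eq_tT /Tend eq_jm eqxx.
    by move: stj; rewrite eq_jm.
  have lt_jm : (j.+1 < m.+1)%N by rewrite ltnS ltn_neqAle neq_jm -ltnS ltn_ord.
  have tE : t = T j.+1 by rewrite eq_tT /Tend (negbTE neq_jm).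
  constructor 2; exists (Ordinal lt_jm).
  apply: (@process_stage st t (Ordinal lt_jm) j) => //.
    rewrite tE lexx /= /Tend; case: eqP => [eq_m|_].
      have -> : T m = T j.+1 by rewrite -[in LHS]eq_m.
      by rewrite ltrDl ltr0n.
    by rewrite [ltRHS]T_S; have := eta_small; lra.
  by right; split=> //; left.
- by constructor 2.
- constructor 3; apply: process_finale; last by left.
  have [t_mem _ _] := mem_next eq_t; have [le_clk st0 _] := stP.
  case: t_mem => [[i [_ lt_t]]|[i [u []]]]; last by rewrite st0.
  by rewrite (le_trans le_clk) // ltW.
by constructor 3.
Qed.

Lemma adversary_completed i : greedy_completed f tie (h * n) i -> group m i.
Proof.
case=> N; case: (simulation N) => [->|[j [_ -> _]]|[_ _ ->]] //=.
all: by rewrite finset.in_set0.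
Qed.

Lemma adversary_class : capacity_class h kappa (h * n) theta.
Proof.
split.
  rewrite leq_mul2l /nmax big_map; apply/orP; right.
  apply/bigmax_leqP_seq => x _ _; rewrite adv_demand.
  by case: x => [[l r]|[k r]] //=; case: ifP.
move=> i; rewrite lab_job; split; rewrite ?adv_demand ?adv_value //.
- case: (lab i) => [[l r]|[k r]] /=; first exact: T_ge0.
  by rewrite SE; have := eta_ltk; have := ler0n R k; lra.
- by case: (lab i) => [[l r]|[k r]] /=; rewrite ?lexx ?kappa_ge1.
by rewrite mulr_gt0 // ltr0n.
Qed.

Let value_gt0 (i : 'I_(size theta)) : 0 < value (job_at i).
Proof. by rewrite lab_job adv_value mulr_gt0 // ltr0n. Qed.

Let last_welfare : R := \sum_(i | group m i) value (job_at i).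

Lemma adversary_welfare_le : greedy_welfare f tie (h * n) theta <= last_welfare.
Proof.
rewrite /greedy_welfare /last_welfare big_mkcond [leRHS]big_mkcond ler_sum // => i _.
case: asboolP => [/adversary_completed->|_] //.
by case: ifP => // _; rewrite ltW.
Qed.

Lemma adversary_welfare_ge0 : 0 <= greedy_welfare f tie (h * n) theta.
Proof. by apply: sumr_ge0 => i _; rewrite ltW. Qed.

Lemma last_welfare_le : last_welfare <= (h.-1 * n).+1%:R * b ^+ m.
Proof.
rewrite /last_welfare -(sum_size ord_max) natr_sum mulr_suml.
rewrite (eq_bigr (fun i => value (adv_job (lab i)))) => [|i _]; last by rewrite lab_job.
rewrite [leLHS](big_group _ ord_max (fun x => value (adv_job x))) ler_sum // => r _.
rewrite ler_wpM2l ?ler0n //=; by case: ifP => _; rewrite ?mul1r // ger_pMl ?exprn_gt0 // ltW.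
Qed.

(** * The offline allocation *)

Let offline (x : I) (t : R) : nat :=
  match x with
  | inl (j, r) => if (j == m :> nat) && (T m.+1 + 1 <= t < T m.+1 + 1 + kappa%:R)
                  then size_of x else 0%N
  | inr (k, r) => if S k <= t < S k + 1 then n else 0%N
  end.

Let sum_all (V : Type) (idx : V) (op : Monoid.com_law idx) (F : I -> V) :
  \big[op/idx]_i F (lab i) =
    op (\big[op/idx]_(j < m.+1) \big[op/idx]_(r < h) F (inl (j, r)))
       (\big[op/idx]_(k < (m * kappa).+1) \big[op/idx]_(r < h) F (inr (k, r))).
Proof.
case: lab_bij => unlab labK unlabK.
rewrite (reindex unlab); last by apply: onW_bij; exists lab.
under eq_bigr do rewrite unlabK.
by rewrite big_sumType /= !pair_bigA; congr (op _ _); apply: eq_bigr => -[].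
Qed.

(** At any time at most one batch runs, its [h] jobs filling the capacity, or else the last group
    alone. *)
Let offline_feasible :
  feasible_allocation (h * n) (fun (i : 'I_(size theta)) t => offline (lab i) t).
Proof.
move=> t _; rewrite (sum_all _ (fun x => offline x t)) /=.
have -> : (\sum_(j < m.+1) \sum_(r < h) offline (inl (j, r)) t =
    if (T m.+1 + 1 <= t < T m.+1 + 1 + kappa%:R)%R then (h.-1 * n).+1 else 0)%N.
  rewrite (bigD1 ord_max) //= [X in (_ + X)%N]big1 ?addn0.
    by case: ifP => _; rewrite eqxx /= ?big1_eq // -(sum_size ord_max).
  move=> l nl; rewrite big1 // => r _.
  by have -> : (l == m :> nat) = false by apply/negbTE.
have hn : (h * n = h.-1 * n + n)%N by rewrite -{1}(prednK h_gt0) mulSn addnC.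
case: ifP => [/andP[le_t _]|_].
  rewrite [X in (_ + X)%N]big1; first by rewrite addn0 hn -addn1 leq_add2l.
  move=> k _.
  rewrite big1 //= => r _; rewrite ifN // negb_and -!leNgt; apply/orP; right.
  apply: le_trans le_t; rewrite lerD2r.
  have: k%:R <= (m * kappa)%:R :> R by rewrite ler_nat.
  by rewrite /S; lra.
rewrite add0n; case: (pickP (fun k : 'I_(m * kappa).+1 => S k <= t < S k + 1)).
  move=> k0 /andP[k0_le k0_lt]; rewrite (bigD1 k0) //= [X in (_ + X)%N]big1 ?addn0.
    by rewrite k0_le k0_lt sum_nat_const card_ord.
  move=> k nk; rewrite big1 // => r _; rewrite ifN //; apply: contra nk.
  move: k0_le k0_lt => + + /andP[]; rewrite /S => le1 lt1 le2 lt2.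
  (* Batches active at the same time start less than one unit apart, yet their starts differ by an
     integer. *)
  by apply/eqP/val_inj/anti_leq/andP; split; rewrite -ltnS -(ltr_nat R) -natr1; lra.
move=> none; rewrite big1 // => k _; rewrite big1 //= => r _.
by rewrite none.
Qed.

Let offline_completed (i : 'I_(size theta)) :
  (if lab i is inl (j, _) then j == m :> nat else true) ->
  completed (fun (i : 'I_(size theta)) t => offline (lab i) t) i.
Proof.
rewrite /completed lab_job; case: (lab i) => [[l r]|[k r]] /=.
  move=> l_m; exists (T m.+1 + 1); rewrite l_m; split=> //; last by move=> t ->.
  by rewrite (eqP l_m) T_S; have := eta_small; lra.
by move=> _; exists (S k); split=> // t ->.
Qed.

Lemma adversary_opt :
  (h * n)%:R * s ^+ 5 * (\sum_(k < (m * kappa).+1) b ^+ (k %/ kappa).+1) + last_welfare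
    <= opt (h * n) theta.
Proof.
set x := fun (i : 'I_(size theta)) t => offline (lab i) t.
apply: (@le_trans _ _ (welfare x)); last first.
  apply: ub_le_sup; last by exists x => //; exact: offline_feasible.
  (* The set of welfares must be bounded above for [sup] to be an upper bound; the total value of
     all jobs bounds it. *)
  exists (\sum_(i < size theta) value (job_at i)) => _ [y _ <-].
  rewrite /welfare big_mkcond ler_sum // => i _.
  by case: ifP => // _; rewrite ltW.
pose chosen (i : 'I_(size theta)) := if lab i is inl (j, _) then j == m :> nat else true.
apply: (@le_trans _ _ (\sum_(i | chosen i) value (job_at i))); last first.
  rewrite /welfare big_mkcond [leRHS]big_mkcond ler_sum // => i _.
  case: ifP => [/offline_completed/asboolP-> //|_].
  by case: ifP => // _; rewrite ltW.
rewrite /last_welfare [X in _ + X]big_mkcond [leRHS]big_mkcond /=.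
pose F (x : I) := if (if x is inl (j, _) then j == m :> nat else true)
  then value (adv_job x) else 0.
pose G (x : I) := if (if x is inl (j, _) then j == m :> nat else false)
  then value (adv_job x) else 0.
rewrite [X in _ + X](eq_bigr (fun i => G (lab i))); last by move=> i _; rewrite lab_job.
rewrite [leRHS](eq_bigr (fun i => F (lab i))); last by move=> i _; rewrite lab_job.
rewrite !sum_all addrC /= [X in _ + X + _]big1 ?addr0; last first.
  by move=> k _; rewrite big1.
rewrite lerD // mulr_sumr ler_sum // => k _.
by rewrite /F /= sumr_const card_ord -[leRHS]mulr_natl natrM !mulrA.
Qed.

(** The value [W] of the last group bounds the greedy welfare and is also earned offline, which
    yields the summand 1 of the ratio. *)
Lemma labelled_bounds : exists W,
  [/\ capacity_class h kappa (h * n) theta,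
      0 <= greedy_welfare f tie (h * n) theta <= W,
      W <= (h.-1 * n).+1%:R * b ^+ m &
      (h * n)%:R * s ^+ 5 * (\sum_(k < (m * kappa).+1) b ^+ (k %/ kappa).+1) + W
        <= opt (h * n) theta].
Proof.
exists last_welfare; split; first exact: adversary_class.
- by rewrite adversary_welfare_ge0 adversary_welfare_le.
- exact: last_welfare_le.
exact: adversary_opt.
Qed.

End Labelled.

Lemma adversary_bounds : exists theta W,
  [/\ capacity_class h kappa (h * n) theta,
      0 <= greedy_welfare f tie (h * n) theta <= W,
      W <= (h.-1 * n).+1%:R * b ^+ m &
      (h * n)%:R * s ^+ 5 * (\sum_(k < (m * kappa).+1) b ^+ (k %/ kappa).+1) + W
        <= opt (h * n) theta].
Proof.
have [lab [lab_bij lab_job]] := labelling adv_job.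
by exists theta; apply: labelled_bounds lab_bij lab_job.
Qed.

End Adversary.

(** * Numerical estimates *)

Lemma sum_divn_powers (R : comNzRingType) (b : R) (kappa m : nat) : (0 < kappa)%N ->
  (b - 1) * \sum_(k < m * kappa) b ^+ (k %/ kappa) = kappa%:R * (b ^+ m - 1).
Proof.
move=> k0; rewrite -(big_mkord xpredT (fun k => b ^+ (k %/ kappa))).
elim: m => [|m IHm]; first by rewrite mul0n big_geq // expr0 subrr !mulr0.
rewrite (@big_cat_nat _ _ _ (m * kappa)) //= ?leq_mul // mulrDr IHm.
rewrite [X in _ + _ * X](eq_big_nat _ _ (F2 := fun=> b ^+ m)); last first.
  move=> k /andP[le1 le2]; congr (_ ^+ _); apply/eqP; rewrite eqn_leq -ltnS.
  by rewrite ltn_divLR // le2 leq_divRL.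
rewrite sumr_const_nat mulSn addnK -mulr_natl exprS; ring.
Qed.

(** The sum equals [(b ^+ m - 1) * (kappa * b / (b - 1) + b) + b]. With [r] the square root of
    [kappa], the excess of the second factor over [(r + 1) ^+ 2] is
    [(r - (b - 1)) ^+ 2 / (b - 1)]. *)
Lemma sum_divn_powers_ge (R : rcfType) (b : R) (kappa m : nat) :
    (0 < kappa)%N -> 1 < b ->
  (b ^+ m - 1) * (Num.sqrt kappa%:R + 1) ^+ 2
    <= \sum_(k < (m * kappa).+1) b ^+ (k %/ kappa).+1.
Proof.
move=> k0 b1; rewrite big_ord_recr /= mulnK //.
under eq_bigr do rewrite exprS.
rewrite -mulr_sumr; set G := \sum_(i < _) _.
have bN : b - 1 != 0 by rewrite subr_eq0 gt_eqF.
have -> : G = kappa%:R * (b ^+ m - 1) / (b - 1).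
  by apply: (mulfI bN); rewrite sum_divn_powers // mulrCA divff // mulr1.
have: Num.sqrt (kappa%:R : R) ^+ 2 = kappa%:R by rewrite sqr_sqrtr.
set r := Num.sqrt _ => <-; have bm1 : 1 <= b ^+ m by rewrite exprn_ege1 // ltW.
rewrite -subr_ge0.
have -> : b * (r ^+ 2 * (b ^+ m - 1) / (b - 1)) + b ^+ m.+1
    - (b ^+ m - 1) * (r + 1) ^+ 2
    = (b ^+ m - 1) * (r - (b - 1)) ^+ 2 / (b - 1) + b.
  by rewrite (exprS b m); field.
apply: addr_ge0; last by lra.
apply: divr_ge0; last by lra.
by apply: mulr_ge0; rewrite ?sqr_ge0 ?subr_ge0.
Qed.

Lemma Bernoulli_sub (R : realDomainType) (e : R) (n : nat) :
  0 <= e <= 1 -> 1 - n%:R * e <= (1 - e) ^+ n.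
Proof.
move=> /andP[e0 e1]; elim: n => [|n IHn]; first by rewrite mul0r subr0.
have p0 : 0 <= (1 - e) ^+ n by rewrite exprn_ge0 // subr_ge0.
have p1 : (1 - e) ^+ n <= 1 by rewrite exprn_ile1 ?subr_ge0 // lerBlDr lerDl.
by rewrite exprS -addn1 natrD; nra.
Qed.

Lemma expr_unbounded (R : archiRealFieldType) (b x : R) :
  1 < b -> exists m, x <= b ^+ m.
Proof.
move=> b1; pose y := Num.max 0 (x / (b - 1)); have b10 : 0 < b - 1 by rewrite subr_gt0.
have y0 : 0 <= y by rewrite le_max lexx.
exists (Num.bound y); set m := Num.bound y.
have lt_ym : y < m%:R by apply: archi_boundP.
have: x <= (b - 1) * m%:R.
  rewrite mulrC -ler_pdivrMr //; apply: le_trans (ltW lt_ym).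
  by rewrite le_max lexx orbT.
move/le_trans; apply; rewrite -[leRHS](subrK 1) subrX1 ler_wpDr //.
rewrite ler_wpM2l ?(ltW b10) //; rewrite -[X in X%:R <= _]card_ord -sumr_const.
by apply: ler_sum => i _; rewrite exprn_ege1 // ltW.
Qed.

(** The point 1 is excluded because [f] may jump there, while preempted jobs have progress below 1.
    The supremum is finite since [f 1] is an upper bound. *)
Lemma priority_sup_adherent (R : realType) (f : R -> R) (s : R) : priority_function f ->
    0 < s < 1 ->
  exists a d, [/\ 1 <= a, 0 <= d < 1, a * s <= f d & forall x, 0 <= x < 1 -> f x <= a].
Proof.
move=> [f0 f_mono] /andP[s0 s1].
pose E : set R := [set y | exists2 x, 0 <= x < 1 & y = f x]%classic.
have supE : has_sup E.
  split; first by exists (f 0), 0; rewrite ?lexx ?ltr01.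
  exists (f 1) => _ [x /andP[x0 /ltW x1] ->].
  by apply: f_mono; rewrite ?x0 ?ler01 ?lexx.
have leE x : 0 <= x < 1 -> f x <= sup E.
  by move=> x01; apply: ub_le_sup; [case: supE | exists x].
have sup1 : 1 <= sup E by rewrite -f0 leE // lexx ltr01.
have eps : 0 < sup E * (1 - s) by rewrite mulr_gt0 ?subr_gt0 // (lt_le_trans ltr01).
have [_ [d d01 ->] lt_d] := sup_adherent eps supE.
exists (sup E), d; split=> //; apply: ltW; apply: le_lt_trans lt_d.
by rewrite mulrBr mulr1 opprB addrC subrK.
Qed.

(** Six factors [s] are lost in all: five in the density of the batches and one in replacing
    [b ^+ m - 1] by [s * b ^+ m]. *)
Lemma exists_expr6_gt (R : realFieldType) (q : R) :
  q < 1 -> exists2 s, 0 < s < 1 & q < s ^+ 6.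
Proof.
(* Dividing by 7 rather than 6 makes [1 - 6 * e] strictly larger than [q]. *)
move=> q1; pose e := Num.min (1 / 2) ((1 - q) / 7).
have e_half : e <= 1 / 2 by rewrite ge_min lexx.
have e_q : e <= (1 - q) / 7 by rewrite ge_min lexx orbT.
have e0 : 0 < e by rewrite lt_min; apply/andP; split; lra.
exists (1 - e); first by apply/andP; split; lra.
apply: lt_le_trans (Bernoulli_sub 6 _); first by lra.
by apply/andP; split; lra.
Qed.

(** * Choice of the parameters and conclusion *)

Lemma adversary_wins (R : realType) (f : R -> R) (tie : rel (snapshot R))
    (h kappa : nat) (x : R) : total tie -> priority_function f ->
    (2 <= h)%N -> (0 < kappa)%N -> 0 < x ->
    (h%:R - 1) * x < h%:R * (Num.sqrt kappa%:R + 1) ^+ 2 ->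
  exists C (theta : seq (job R)),
    [/\ capacity_class h kappa C theta, 0 <= greedy_welfare f tie C theta &
        (x + 1) * greedy_welfare f tie C theta < opt C theta].
Proof.
move=> tie_total f_prio h2 k0 x0; set K := _ ^+ 2 => lt_x.
have h1 : 2 <= h%:R :> R by rewrite ler_nat.
have K0 : 0 < K by rewrite exprn_gt0 // ltr_wpDl ?sqrtr_ge0.
have hK0 : 0 < h%:R * K by rewrite mulr_gt0 //; lra.
have [|s /andP[s0 s1] lt_s] := @exists_expr6_gt R ((h%:R - 1) * x / (h%:R * K)).
  by rewrite ltr_pdivrMr // mul1r.
have {}lt_s : (h%:R - 1) * x < s ^+ 6 * (h%:R * K) by rewrite -ltr_pdivrMr.
have [|a [d [a1 /andP[d0 d1] f_d f_le]]] := priority_sup_adherent f_prio (s := s).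
  by rewrite s0.
pose b := a / s ^+ 2; have s2 : 0 < s ^+ 2 by rewrite exprn_gt0.
have bs2 : b * s ^+ 2 = a by rewrite divfK // gt_eqF.
have b1 : 1 < b.
  by rewrite ltr_pdivlMr // mul1r (lt_le_trans _ a1) // exprn_ilt1 // ltW.
have s1' : 0 < 1 - s by rewrite subr_gt0.
(* A long chain makes the [- 1] in [b ^+ m - 1] cost at most one factor [s]. *)
have [m le_m] := expr_unbounded (1 - s)^-1 b1.
have {}le_m : s * b ^+ m <= b ^+ m - 1.
  by move: le_m; rewrite -div1r ler_pdivrMr //; lra.
pose gap := s ^+ 6 * (h%:R * K) - (h%:R - 1) * x.
have gap0 : 0 < gap by rewrite subr_gt0.
(* A large [n] absorbs the extra unit in [(h.-1 * n).+1], due to the job of demand 1. *)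
pose n := Num.bound (x / gap).
have lt_n : x < n%:R * gap.
  by rewrite -ltr_pdivrMr // archi_boundP // ltW // divr_gt0.
have n0 : (0 < n)%N.
  by rewrite lt0n; apply/eqP => n0; move: lt_n; rewrite n0 mul0r ltNge ltW.
pose eta := kappa%:R * (1 - d) / m.+2%:R.
have kd : 0 < kappa%:R * (1 - d) by rewrite mulr_gt0 ?ltr0n ?subr_gt0.
have eta0 : 0 < eta by rewrite divr_gt0 ?ltr0n.
have lt_eta : m.+1%:R * eta < kappa%:R * (1 - d).
  by rewrite /eta mulrCA gtr_pMr // ltr_pdivrMr ?ltr0n // mul1r ltr_nat.
have [theta [W [cls /andP[W0 le_W] le_V le_opt]]] := adversary_bounds tie_total f_prio
  h2 k0 n0 s0 s1 a1 bs2 d0 d1 f_le f_d eta0 lt_eta.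
exists (h * n)%N, theta; split=> //; apply: lt_le_trans le_opt.
apply: (@le_lt_trans _ _ ((x + 1) * W)); first by rewrite ler_wpM2l // addr_ge0 // ltW.
rewrite mulrDl mul1r ltrD2r.
apply: (@le_lt_trans _ _ (x * ((h.-1 * n).+1%:R * b ^+ m))).
  by rewrite ler_wpM2l // ltW.
have bm0 : 0 < b ^+ m by rewrite exprn_gt0 // (lt_trans ltr01).
have n0' : 0 < n%:R :> R by rewrite ltr0n.
have c0 : 0 < (h * n)%:R * s ^+ 5 by rewrite mulr_gt0 ?exprn_gt0 // natrM mulr_gt0 //; lra.
apply: (@lt_le_trans _ _ ((h * n)%:R * s ^+ 5 * (s * b ^+ m * K))); last first.
  rewrite ler_pM2l //; apply: le_trans (sum_divn_powers_ge m k0 b1).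
  by rewrite ler_wpM2r // ltW.
have -> : (h * n)%:R * s ^+ 5 * (s * b ^+ m * K) = n%:R * (s ^+ 6 * (h%:R * K)) * b ^+ m.
  by rewrite natrM; ring.
have -> : (h.-1 * n).+1%:R = (h%:R - 1) * n%:R + 1 :> R.
  by rewrite -natr1 natrM -subn1 natrB // ltnW.
by rewrite [ltLHS]mulrA ltr_pM2r //; move: lt_n; rewrite /gap; lra.
Qed.

Theorem theorem3p10 (R : realType) (h kappa : nat) (f : R -> R)
    (tie : rel (snapshot R)) (hh : (2 <= h)%N) (hkappa : (1 <= kappa)%N)
    (hf : priority_function f) (htie : linear_order tie) :
  ((h%:R / (h%:R - 1) * (Num.sqrt kappa%:R + 1) ^+ 2 + 1)%:E
    <= competitive_ratio (greedy_welfare f tie)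
         (capacity_class (R := R) h kappa))%E.
Proof.
have h1 : 2 <= h%:R :> R by rewrite ler_nat.
have h10 : 0 < h%:R - 1 :> R by lra.
have K1 : 1 <= (Num.sqrt kappa%:R + 1) ^+ 2 :> R.
  by rewrite exprn_ege1 // lerDr sqrtr_ge0.
set K : R := _ ^+ 2 in K1 *; case: htie => tie_total _ _.
apply: le_ereal_inf_tmp => _ [c comp_c <-]; rewrite lee_fin leNgt; apply/negP => lt_c.
have B0 : 0 < h%:R / (h%:R - 1) * K by rewrite mulr_gt0 ?divr_gt0 //; lra.
(* Since [c - 1] may be negative, half of the bound is used as a floor: [x] has to be positive,
   below the bound, and such that [c <= x + 1]. *)
pose x := Num.max (c - 1) (h%:R / (h%:R - 1) * K / 2).
have x0 : 0 < x by rewrite lt_max divr_gt0 ?orbT // ltr0n.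
have lt_x : x < h%:R / (h%:R - 1) * K by rewrite gt_max; apply/andP; split; lra.
have [|C [theta [cls W0 lt_opt]]] := adversary_wins tie_total hf hh hkappa x0.
  by rewrite mulrC -ltr_pdivlMr // mulrAC.
apply: (comp_c C theta cls); apply: le_lt_trans lt_opt; rewrite ler_wpM2r //.
by rewrite -lerBlDr le_max lexx.
Qed.
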